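(* Let $h>0$, $\mu>0$ and $\theta\in[0,\pi/2)$. In a non-Beerian (zero dissipation) two-sided porous bed of height $h$ with opaque particles, whose homogenized beam length distribution is exponential with rate $\mu$ (density $\mu e^{-\mu y}$ on $y\ge0$), the reflection fraction $\rho_\theta$ for incident angle $\theta$ is exactly $$\rho_\theta=\frac{(1-\cos\theta)\left(1-e^{-\frac{h\mu}{\cos\theta}}\right)+h\mu}{h\mu+2}.$$
   Context: Model. A beam enters the slab of depths $[0,h]$ at depth $0$ with incident angle $\theta$. Let $x,Y_1,Y_2,\dots$ be i.i.d. random variables with the beam length distribution (here exponential with rate $\mu$), and let $s_1,s_2,\dots$ be i.i.d. signs, uniform on $\{1,-1\}$, independent of them. The first scattering point has depth $\tilde x=x\cos\theta$. If $\tilde x>h$, the beam is transmitted without scattering (and contributes no reflection). If $\tilde x\le h$, the successive scattering depths are $\tilde x+\sum_{i=1}^{n}s_iY_i$, $n\ge1$, and the process stops at the first time $$T=\min\Big\{n\ge1:\ \tilde x+\sum_{i=1}^n s_iY_i<0\ \text{ or }\ \tilde x+\sum_{i=1}^n s_iY_i>h\Big\}.$$ The beam is reflected if at the stopping time the depth is $<0$ and transmitted if it is $>h$. There is no absorption, so the reflection fraction $\rho_\theta$ is the probability of reflection: $$\rho_\theta=\mathbb{P}\Big(\tilde x\le h\ \text{ and }\ \tilde x+\sum_{i=1}^{T}s_iY_i<0\Big).$$ *)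

(* Defs.v *)
From HB Require Import structures.
From mathcomp Require Import all_boot all_order all_algebra finmap.
From mathcomp Require Import all_classical all_reals all_analysis.

Set Implicit Arguments.
Unset Strict Implicit.
Unset Printing Implicit Defensive.

Import Order.TTheory GRing.Theory Num.Theory.

Local Open Scope classical_set_scope.
Local Open Scope ring_scope.

(* Mutual independence: the product rule for every finite subfamily. *)
Definition mutually_independent (d : measure_display) (T : measurableType d)
    (R : realType) (P : probability T R) (I : choiceType)
    (X : I -> {RV P >-> R}) : Prop :=
  forall (J : {fset I}) (A : I -> set R), (forall i, measurable (A i)) ->
    P (\bigcap_(i in [set` J]) (X i @^-1` A i)) =
    (\prod_(i <- J) P (X i @^-1` A i))%E.

Definition has_exponential_law (d : measure_display) (T : measurableType d)
    (R : realType) (P : probability T R) (mu : R) (X : {RV P >-> R}) : Prop :=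
  forall A : set R, measurable A -> distribution P X A = exponential_prob mu A.

Definition is_uniform_sign (d : measure_display) (T : measurableType d)
    (R : realType) (P : probability T R) (s : {RV P >-> R}) : Prop :=
  P [set w | s w = 1] = (2^-1)%:E /\ P [set w | s w = -1] = (2^-1)%:E.

Section two_sided_beam.
Context (d : measure_display) (T : measurableType d) (R : realType).
Context (P : probability T R).

(* The lengths [Y_1, Y_2, ...] and signs [s_1, s_2, ...] are indexed from 0:
   [Y i] and [s i] stand for [Y_(i+1)] and [s_(i+1)]. *)
Variables (x : {RV P >-> R}) (Y s : nat -> {RV P >-> R}).

Definition beam_family (i : option (nat + nat)) : {RV P >-> R} :=
  match i with
  | None => x
  | Some (inl n) => Y n
  | Some (inr n) => s n
  end.

Record beam_model (mu : R) : Prop := BeamModel {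
  beam_first_length : has_exponential_law mu x;
  beam_length : forall n, has_exponential_law mu (Y n);
  beam_sign : forall n, is_uniform_sign (s n);
  beam_independent : mutually_independent beam_family
}.

Variables (h theta : R).

Definition first_depth (w : T) : R := x w * cos theta.

Definition scattering_depth (n : nat) (w : T) : R :=
  first_depth w + \sum_(i < n) s i w * Y i w.

Definition outside_slab (z : R) : Prop := z < 0 \/ h < z.

(* [stops_at n w] says that the stopping time of the outcome [w] is [n]; outcomes
   that never leave the slab stop at no [n]. *)
Definition stops_at (n : nat) (w : T) : Prop :=
  [/\ (1 <= n)%N, outside_slab (scattering_depth n w) &
      forall k : nat, (1 <= k < n)%N -> ~ outside_slab (scattering_depth k w)].

Definition reflected : set T :=
  [set w | first_depth w <= h /\
           exists n, stops_at n w /\ scattering_depth n w < 0].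

Definition reflection_fraction : \bar R := P reflected.

End two_sided_beam.

(* Main.v *)
Require Import Defs.
From HB Require Import structures.
From mathcomp Require Import all_boot all_order all_algebra finmap.
From mathcomp Require Import all_classical all_reals all_analysis.
From mathcomp Require Import measurable_realfun ring lra.

(**
Conditionally on its current depth [z] in the slab, a beam is eventually
reflected with probability [q z = (1 + (h - z) mu) / (h mu + 2)]. Extended by 1
below the slab and by 0 above it, [q] is harmonic for the walk: a step
forward changes its mean by [- 1 / (h mu + 2)] and a step backward by the
opposite amount. Let [a n] be the integral of [q (Z n)] over the event [S n]
that the depths [Z 0, ..., Z n] all lie in the slab. Since step [n] is
independent of the past, [a n = P (S n, Z (n + 1) < 0) + a (n + 1)], and
[a n <= P (S n) <= (1 - exp (- mu h)) ^ n] because a step longer than [h] always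
leaves the slab. Summing, the reflection probability is [a 0], the integral of
[q (x cos theta)] over [x cos theta <= h].
*)

Set Implicit Arguments.
Unset Strict Implicit.
Unset Printing Implicit Defensive.

Import Order.TTheory GRing.Theory Num.Theory.
Import numFieldNormedType.Exports.

Local Open Scope classical_set_scope.
Local Open Scope ring_scope.

(** * Integrals against an exponential law *)

Section exponential_integrals.
Context (R : realType) (rate : R) (m : probability (measurableTypeR R) R).
Hypotheses (rate_gt0 : 0 < rate)
  (mE : forall A : set R, measurable A -> m A = exponential_prob rate A).
Notation leb := (@lebesgue_measure R).

Lemma exponential_dominates : m `<< leb.
Proof.
apply/null_content_dominatesP => A mA A0; rewrite mE//.
apply: null_set_integral => //.
apply/measurable_EFinP/measurable_funTS; exact: measurable_exponential_pdf.
Qed.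

(** Change of variables with the Radon-Nikodym derivative of [m]. The density can replace that
    derivative because both have integral [m E] over every measurable [E] inside [D], hence agree
    almost everywhere on [D]. *)
Lemma integral_exponential (f : R -> \bar R) (D : set R) :
  measurable D -> m.-integrable D f ->
  (\int[m]_(y in D) f y =
   \int[leb]_(y in D) (f y * (exponential_pdf rate y)%:E))%E.
Proof.
move=> mD intf.
have dom := exponential_dominates.
have mpdf : measurable_fun D (EFin \o exponential_pdf rate).
  by apply/measurable_EFinP/measurable_funTS; exact: measurable_exponential_pdf.
have intRN : leb.-integrable D
    (Radon_Nikodym (charge_of_finite_measure m) leb).
  apply: (@integrableS _ _ _ _ setT) => //.
  exact: Radon_Nikodym_integrable.
have mf := measurable_int _ intf.
rewrite -(Radon_Nikodym_change_of_variables dom)//.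
apply: ae_eq_integral => //.
- by apply: emeasurable_funM => //; exact: (measurable_int leb).
- by apply: emeasurable_funM.
- apply: ae_eqe_mul2l.
  apply: integral_ae_eq => // E ED mE'.
  by rewrite -Radon_Nikodym_integral//= mE.
Qed.

Lemma exponential_itvcc (L : R) : 0 <= L ->
  m `[0%R : R, L]%classic = (1 - expR (- (rate * L)))%:E.
Proof.
rewrite le_eqVlt => /predU1P[<-|L0]; rewrite mE//.
  rewrite mulr0 oppr0 expR0 subrr set_itv1.
  exact: integral_set1.
by rewrite exponential_prob_itv0c// mulNr EFinB.
Qed.

Lemma exponential_itvNyo : m `]-oo, 0%R : R[%classic = 0.
Proof.
rewrite mE//; apply: integral0_eq => y; rewrite /= in_itv/= => y0.
by rewrite lt0_exponential_pdf.
Qed.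

Lemma exponential_itvoy (L : R) : 0 <= L ->
  m `]L, +oo[%classic = (expR (- (rate * L)))%:E.
Proof.
move=> L0; have -> : `]L, +oo[%classic = ~` (`]-oo, 0[ `|` `[0, L]).
  apply/seteqP; split => y; rewrite /= !in_itv/= ?andbT.
    by move=> Ly [|]; lra.
  by move=> H; rewrite ltNge; apply/negP => yL; apply: H; have [|] := ltP y 0;
    [left|right; rewrite yL].
transitivity (1 - (m `]-oo, 0%R : R[%classic + m `[0%R : R, L]%classic))%E.
  rewrite probability_setC//; last exact: measurableU.
  rewrite measureU//.
  by apply/seteqP; split => y //=; rewrite !in_itv/= => -[]; lra.
rewrite exponential_itvNyo exponential_itvcc// add0e -EFinB.
by congr EFin; lra.
Qed.

Lemma integral_affine_exponential_pdf (L a b : R) : 0 <= L ->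
  (\int[leb]_(y in `[0%R, L]) ((a + b * y)%:E * (exponential_pdf rate y)%:E) =
    (a + b / rate - expR (- (rate * L)) * (a + b * L + b / rate))%:E)%E.
Proof.
rewrite le_eqVlt => /predU1P[<-|L0].
  rewrite set_itv1 integral_set1; congr EFin.
  by rewrite !mulr0 oppr0 expR0; ring.
(* [F] is the primitive given by integration by parts. The case [L = 0] was treated apart because
   the fundamental theorem of calculus is applied on a nondegenerate interval. *)
pose F y : R^o := - (expR (- rate * y) * (a + b * y + b / rate)).
have dF (y : R) : is_derive y 1 F ((a + b * y) * (rate * expR (- rate * y))).
  rewrite /F; apply: is_derive_eq.
  rewrite /GRing.scale /=; field; exact: lt0r_neq0.
have cF : continuous F.
  move=> y; apply/differentiable_continuous/derivable1_diffP.
  exact: ex_derive.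
transitivity (\int[leb]_(y in `[0%R, L])
    ((a + b * y) * (rate * expR (- rate * y)))%:E)%E.
  apply: eq_integral => y; rewrite inE/= in_itv/= => /andP[y0 _].
  by rewrite exponential_pdfE// EFinM.
rewrite (@continuous_FTC2 _ _ F)//.
- by rewrite /F -EFinB; congr EFin; rewrite mulr0 expR0 mulNr; ring.
- apply: continuous_subspaceT => y.
  apply/differentiable_continuous/derivable1_diffP; exact: ex_derive.
- split; first by move=> y _; exact: ex_derive.
    by apply/cvg_at_right_filter; exact: cF.
  by apply/cvg_at_left_filter; exact: cF.
- by move=> y _; rewrite derive1E; exact: derive_val.
Qed.

(** Every integrand met below has this shape: affine in the length as long as the beam stays in the
    slab, constant once it has left. Nothing but the bounds is asked of [g] on negative lengths,
    which form a null set. In the result [a + b / rate] is the mean of the affine function continued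
    to all lengths, and the exponential term corrects for replacing it by [c] beyond [L]. *)
Lemma integral_exponential_affine (L a b c : R) (g : R -> R) : 0 <= L ->
  measurable_fun setT g -> (forall y, 0 <= g y <= 1) ->
  (forall y, 0 <= y <= L -> g y = a + b * y) ->
  (forall y, L < y -> g y = c) ->
  (\int[m]_y (g y)%:E =
    (a + b / rate - expR (- (rate * L)) * (a + b * L + b / rate - c))%:E)%E.
Proof.
move=> L0 mg g01 gaff gc.
have g0 y : (0 <= (g y)%:E)%E by rewrite lee_fin; have /andP[] := g01 y.
have mgE D : measurable_fun D (EFin \o g).
  by apply/measurable_EFinP/measurable_funTS.
have -> : [set: R] = `]-oo, 0[ `|` (`[0, L] `|` `]L, +oo[).
  apply/seteqP; split => y //= _; rewrite !in_itv/= andbT.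
  have [y0|y0] := ltP y 0; first by left.
  by right; have [Ly|yL] := ltP L y; [right|left].
have m0L : measurable (`[0, L]%classic : set (measurableTypeR R)) by [].
have mLy : measurable (`]L, +oo[%classic : set (measurableTypeR R)) by [].
have mU := measurableU _ _ m0L mLy.
rewrite ge0_integral_setU//=; last 2 first.
- exact: mgE.
- by apply/disj_setPS => y /=; rewrite !in_itv/= andbT => -[y0 [|]]; lra.
rewrite null_set_integral//; [|exact: mgE|exact: exponential_itvNyo].
rewrite add0e ge0_integral_setU//=; last 2 first.
- exact: mgE.
- by apply/disj_setPS => y /=; rewrite !in_itv/= andbT => -[]; lra.
have -> : (\int[m]_(y in `]L, +oo[) (g y)%:E = (c * expR (- (rate * L)))%:E)%E.
  rewrite EFinM -exponential_itvoy// -integral_cst//.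
  by apply: eq_integral => y; rewrite inE/= in_itv/= andbT => Ly; rewrite gc.
rewrite integral_exponential//; last first.
  apply: (@le_integrable _ _ _ _ _ _ _ (cst 1%E)) => //; first exact: mgE.
    move=> y _; have /andP[gy0 gy1] := g01 y.
    by rewrite /= lee_fin normr1 ger0_norm.
  exact: finite_measure_integrable_cst.
transitivity (\int[leb]_(y in `[0%R, L]) ((a + b * y)%:E *
    (exponential_pdf rate y)%:E) + (c * expR (- (rate * L)))%:E)%E.
  congr (_ + _)%E; apply: eq_integral => y.
  by rewrite inE/= in_itv/= => /gaff ->.
by rewrite integral_affine_exponential_pdf// -EFinD; congr EFin; ring.
Qed.

End exponential_integrals.

(** * Independence of the sigma-algebras generated by disjoint subfamilies *)

Section independence.
Context d (T : measurableType d) (R : realType) (P : probability T R).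

(** For fixed [F], the sets [E] obeying the product rule form a Dynkin system, and [G] is a
    pi-system contained in it. *)
Lemma independent_g_sigma_algebra (G : set (set T)) (F : set T) :
  setI_closed G -> G `<=` measurable -> measurable F ->
  (forall E, G E -> P (E `&` F) = (P E * P F)%E) ->
  forall E, <<s G >> E -> P (E `&` F) = (P E * P F)%E.
Proof.
move=> GI Gm mF PG.
pose H := [set E | measurable E /\ P (E `&` F) = (P E * P F)%E].
suff: <<s G >> `<=` H by move=> GH E /GH [].
apply: lambda_system_subset => //; last first.
  by move=> E GE; split; [exact: Gm|exact: PG].
apply/dynkin_lambda_system; split.
- by split => //; rewrite setTI probability_setT mul1e.
- move=> E [mE PE]; split; first exact: measurableC.
  have PF : P (F `\` E) = (P F - P (E `&` F))%E.
    by rewrite (setIC E) measureD// ltey_eq fin_num_measure.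
  rewrite setIC -setDE PF PE probability_setC//.
  rewrite muleBl ?mul1e ?fin_num_measure// fin_num_adde_defr//.
- move=> E tE HE; have mE n : measurable (E n) by have [] := HE n.
  split; first exact: bigcup_measurable.
  rewrite setI_bigcupl !measure_bigcup//=; last 2 first.
  + by move=> n _; exact: measurableI.
  + exact: trivIset_setIr.
  rewrite muleC -[P F]fineK ?fin_num_measure// -nneseriesZl//.
  apply: eq_eseriesr => n _; rewrite fineK ?fin_num_measure// muleC.
  by have [] := HE n.
Qed.

Context (I : choiceType) (X : I -> {RV P >-> R}).

Definition cylinder (J : {fset I}) (A : I -> set R) : set T :=
  \bigcap_(i in [set` J]) (X i @^-1` A i).

(** A pi-system generating the same sigma-algebra as the variables [X i] with [i] in [J];
    [<<s cylinders J >>] stands for the latter throughout. *)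
Definition cylinders (J : {fset I}) : set (set T) :=
  [set cylinder J A | A in [set A | forall i, measurable (A i)]].

Lemma measurable_cylinders J : cylinders J `<=` measurable.
Proof.
move=> _ [A mA <-]; apply: fin_bigcap_measurable => // i _.
exact: measurable_funPTI.
Qed.

Lemma cylinders_setI J : setI_closed (cylinders J).
Proof.
move=> _ _ [A mA <-] [B mB <-]; exists (fun i => A i `&` B i).
  by move=> i; exact: measurableI.
by rewrite /cylinder -bigcapI.
Qed.

Lemma measurable_cylinders_RV J i : i \in J ->
  measurable_fun [set: g_sigma_algebraType (cylinders J)]
    (X i : g_sigma_algebraType (cylinders J) -> R).
Proof.
move=> iJ _ A mA; rewrite setTI; apply: sub_sigma_algebra.
(* A condition on [X i] alone is a cylinder with no constraint at the other indices. *)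
exists (fun j => if j == i then A else setT).
  by move=> j; case: ifP.
apply/seteqP; split => [w /(_ i iJ)|w Aw j _] /=; first by rewrite eqxx.
by case: eqP => [->|].
Qed.

Hypothesis indep : mutually_independent X.

(** The Dynkin argument is applied twice, first to pass from cylinders to general [E], then, with a
    cylinder over [J] fixed, to general [F]. This leaves the product rule for two cylinders. *)
Lemma independent_cylinders J K : [disjoint J & K]%fset ->
  forall E F, <<s cylinders J >> E -> <<s cylinders K >> F ->
  P (E `&` F) = (P E * P F)%E.
Proof.
move=> JK E F JE KF.
have mF : measurable F.
  apply: smallest_sub KF; first exact: sigma_algebra_measurable.
  exact: measurable_cylinders.
apply: independent_g_sigma_algebra JE => //.
- exact: cylinders_setI.
- exact: measurable_cylinders.
- move=> {}E JE; have mE : measurable E by exact: measurable_cylinders JE.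
  rewrite setIC muleC; apply: independent_g_sigma_algebra KF => //.
  + exact: cylinders_setI.
  + exact: measurable_cylinders.
  move=> _ [B mB <-]; case: JE => A mA <-.
  (* As [J] and [K] are disjoint, the two cylinders glue into a single one over their union, and
     mutual independence factors all three probabilities. *)
  pose C i := if i \in J then A i else B i.
  have CA i : i \in J -> C i = A i by rewrite /C => ->.
  have CB i : i \in K -> C i = B i.
    by rewrite /C; case: ifPn => // iJ; rewrite (negbTE (fdisjointP JK _ iJ)).
  have -> : cylinder K B `&` cylinder J A = cylinder (J `|` K)%fset C.
    apply/seteqP; split => [w [wB wA] i /=|w wC].
      rewrite inE => /orP[iJ|iK]; first by rewrite CA//; exact: wA.
      by rewrite CB//; exact: wB.
    by split=> i /= iJK; [rewrite -CB|rewrite -CA] => //; apply: wC;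
      rewrite /= inE iJK ?orbT.
  rewrite /cylinder !indep//; last by move=> i; rewrite /C; case: ifP.
  rewrite (perm_big (J ++ K)%SEQ) ?big_cat/=; last first.
    apply: uniq_perm; rewrite ?fset_uniq// ?cat_uniq ?fset_uniq/= ?andbT.
      by apply/hasPn => i iK; apply/negP => iJ;
        move: (fdisjointP JK _ iJ); rewrite iK.
    by move=> i; rewrite mem_cat inE.
  rewrite muleC; congr (_ * _)%E; apply: eq_fbigr => i iJK _.
    by rewrite CB.
  by rewrite CA.
Qed.

End independence.

(** * Integrating a function of two independent variables *)

Section freezing.
Context d d1 d2 (T : measurableType d) (T1 : measurableType d1)
  (T2 : measurableType d2) (R : realType) (P : probability T R).

(** By uniqueness of the product measure, the joint law of [W] and [V] is the product of their laws,
    and Tonelli applies. This serves as conditioning on [W]: its value is frozen while [V] is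
    averaged. *)
Lemma integral_independent (W : T -> T1) (V : T -> T2)
    (phi : T1 * T2 -> \bar R) :
  measurable_fun setT W -> measurable_fun setT V ->
  (forall A B, measurable A -> measurable B ->
    P (W @^-1` A `&` V @^-1` B) = (P (W @^-1` A) * P (V @^-1` B))%E) ->
  measurable_fun setT phi -> (forall z, 0 <= phi z)%E ->
  (\int[P]_w phi (W w, V w) = \int[P]_w \int[P]_w' phi (W w, V w'))%E.
Proof.
move=> mW mV WV mphi phi0.
have mWV : measurable_fun setT (fun w => (W w, V w)).
  exact: measurable_fun_pair.
pose W' : {RV P >-> T1} := HB.pack W (isMeasurableFun.Build _ _ _ _ _ mW).
pose V' : {RV P >-> T2} := HB.pack V (isMeasurableFun.Build _ _ _ _ _ mV).
pose WV' : {RV P >-> (T1 * T2)%type} :=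
  HB.pack (fun w => (W w, V w)) (isMeasurableFun.Build _ _ _ _ _ mWV).
transitivity (\int[distribution P WV']_z phi z)%E.
  by rewrite ge0_integral_distribution.
transitivity (\int[distribution P W' \x distribution P V']_z phi z)%E.
  apply: eq_measure_integral => A mA _.
  by apply/esym/product_measure_unique => // B C mB mC; exact: WV.
rewrite fubini_tonelli1// ge0_integral_distribution//; last 2 first.
- exact: measurable_fun_fubini_tonelli_F.
- by move=> y; exact: integral_ge0.
apply: eq_integral => w _ /=; rewrite /fubini_F ge0_integral_distribution//.
exact: measurableT_comp.
Qed.

End freezing.

(** * Expectations and tails of an exponential random variable *)

Section exponential_random_variable.
Context d (T : measurableType d) (R : realType) (P : probability T R).
Variables (rate : R) (X : {RV P >-> R}).
Hypotheses (rate_gt0 : 0 < rate) (Xexp : has_exponential_law rate X).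

(* [lebesgue_measure] lives on [measurableTypeR R], which has the measurable
   sets of [R] but another display. *)
Let X' : T -> measurableTypeR R := X.
Let mX' : measurable_fun setT X'.
Proof. exact: (@measurable_funP _ _ _ _ _ X). Qed.

Let XR : {RV P >-> measurableTypeR R} :=
  HB.pack X' (isMeasurableFun.Build _ _ _ _ _ mX').

Lemma expectation_exponential_affine (L a b c : R) (g : R -> R) : 0 <= L ->
  measurable_fun setT g -> (forall y, 0 <= g y <= 1) ->
  (forall y, 0 <= y <= L -> g y = a + b * y) ->
  (forall y, L < y -> g y = c) ->
  (\int[P]_w (g (X w))%:E =
    (a + b / rate - expR (- (rate * L)) * (a + b * L + b / rate - c))%:E)%E.
Proof.
move=> L0 mg g01 gaff gc.
rewrite -(@integral_exponential_affine R rate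
  (distribution P XR) _ _ _ _ _ _ g)//.
rewrite ge0_integral_distribution//.
- exact/measurable_EFinP.
- by move=> y; rewrite lee_fin; have /andP[] := g01 y.
Qed.

Lemma exponential_lt0 : P [set w | X w < 0] = 0.
Proof.
exact: (@exponential_itvNyo R rate (distribution P XR)).
Qed.

Lemma exponential_le (L : R) : 0 <= L ->
  P [set w | X w <= L] = (1 - expR (- (rate * L)))%:E.
Proof.
move=> L0.
have -> : [set w | X w <= L] = ~` (X' @^-1` `]L, +oo[).
  by apply/seteqP; split => w /=; rewrite in_itv/= andbT leNgt => /negP.
have mL : measurable (X' @^-1` `]L, +oo[).
  by rewrite -[X in measurable X]setTI; exact: mX'.
rewrite probability_setC// EFinB.
by rewrite -(@exponential_itvoy R rate (distribution P XR)).
Qed.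

End exponential_random_variable.

(** * The scattering walk, its past and its next step *)

Section reflection.
Context d (T : measurableType d) (R : realType) (P : probability T R).
Variables (x : {RV P >-> R}) (Y s : nat -> {RV P >-> R}) (h mu theta : R).
Hypotheses (h_gt0 : 0 < h) (mu_gt0 : 0 < mu) (cos_gt0 : 0 < cos theta)
  (model : beam_model x Y s mu).

Let c := cos theta.
Let Z n w := scattering_depth x Y s theta n w.
Let X := beam_family x Y s.

(** Indices of the variables that determine the depths up to time [n]: the first length, and the
    lengths and signs of the steps numbered below [n]. Step [n], which leads to depth [n.+1], uses
    those of [present n]. *)
Let history n : {fset option (nat + nat)} :=
  [fset i in None :: [seq Some (inl k) | k <- iota 0 n]
                  ++ [seq Some (inr k) | k <- iota 0 n]]%fset.
Let present n : {fset option (nat + nat)} :=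
  [fset Some (inl n); Some (inr n)]%fset.

(** The sample space with the sigma-algebra of the history, so that being a function of the past is
    expressed as measurability on [past n]. *)
Let past n := g_sigma_algebraType (cylinders X (history n)).

Lemma history_present n : [disjoint history n & present n]%fset.
Proof.
apply/fdisjointP => i; rewrite !inE.
move=> /orP[/eqP->//|/orP[]/mapP[k + ->]]; rewrite mem_iota/= add0n => kn;
  by rewrite !(inj_eq Some_inj)/= /eq_op/= ?orbF ?ltn_eqF.
Qed.

Lemma measurable_depth n k : (k <= n)%N ->
  measurable_fun [set: past n] (Z k : past n -> R).
Proof.
move=> kn; apply: measurable_funD.
  apply: measurable_funM => //.
  apply: (@measurable_cylinders_RV _ _ _ _ _ X _ None).
  by rewrite !inE.
apply: measurable_sum => i; apply: measurable_funM.
  apply: (@measurable_cylinders_RV _ _ _ _ _ X _ (Some (inr (val i)))).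
  rewrite !inE/=; apply/orP; right.
  by apply: map_f; rewrite mem_iota/= (leq_trans (ltn_ord i)).
apply: (@measurable_cylinders_RV _ _ _ _ _ X _ (Some (inl (val i)))).
rewrite !inE/=; apply/orP; left.
by apply: map_f; rewrite mem_iota/= (leq_trans (ltn_ord i)).
Qed.

Let step n w := s n w * Y n w.

Lemma depthS n w : Z n.+1 w = Z n w + step n w.
Proof. by rewrite /Z /scattering_depth big_ord_recr/= addrA. Qed.

Lemma measurable_step n :
  measurable_fun [set: g_sigma_algebraType (cylinders X (present n))]
    (step n : g_sigma_algebraType (cylinders X (present n)) -> R).
Proof.
apply: measurable_funM.
  apply: (@measurable_cylinders_RV _ _ _ _ _ X _ (Some (inr n))).
  by rewrite !inE eqxx orbT.
apply: (@measurable_cylinders_RV _ _ _ _ _ X _ (Some (inl n))).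
by rewrite !inE eqxx.
Qed.

(** The event [S n] of the overview. Time 0 is included, so the first depth must also be
    nonnegative, which [reflected] does not ask. *)
Let survives n : set T :=
  \bigcap_(k in [set k | (k <= n)%N]) (Z k @^-1` `[0, h]).

Lemma measurable_survives n : measurable (survives n : set (past n)).
Proof.
apply: bigcap_measurable => [|k kn]; first by exists 0.
by rewrite -[X in measurable X]setTI; apply: measurable_depth.
Qed.

(** * The function [q] of the overview and its harmonicity *)

Definition escape_prob (z : R) : R :=
  if z < 0 then 1 else if z <= h then (1 + (h - z) * mu) / (h * mu + 2) else 0.

Lemma measurable_escape_prob : measurable_fun setT escape_prob.
Proof.
apply: measurable_fun_ifT => //; first exact: measurable_fun_ltr.
apply: measurable_fun_ifT => //; first exact: measurable_fun_ler.
apply: measurable_funM => //; apply: measurable_funD => //.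
by apply: measurable_funM => //; exact: measurable_funB.
Qed.

Lemma escape_prob_itv z : 0 <= escape_prob z <= 1.
Proof.
rewrite /escape_prob; case: (ltP z 0) => z0; first lra.
case: (leP z h) => zh; last lra.
have D0 : 0 < h * mu + 2 by rewrite addr_gt0 ?mulr_gt0.
have zmu : 0 <= z * mu by rewrite mulr_ge0// ltW.
have hzmu : 0 <= (h - z) * mu by rewrite mulr_ge0 ?subr_ge0// ltW.
rewrite divr_ge0 ?(ltW D0)//=; last lra.
by rewrite ler_pdivrMr//; lra.
Qed.

Let D_gt0 : 0 < h * mu + 2. Proof. by rewrite addr_gt0 ?mulr_gt0. Qed.

Lemma escape_prob_slab z : 0 <= z <= h ->
  escape_prob z = (1 + (h - z) * mu) / (h * mu + 2).
Proof. by move=> /andP[z0 zh]; rewrite /escape_prob ltNge z0 zh. Qed.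

(** By lack of memory the overshoot above [h] has mean [1 / mu], so the affine formula continued
    above the slab averages there to 0, the true value. Only slope times mean length remains, that
    is [- 1 / (h mu + 2)]. In the computation the coefficient of the exponential vanishes. *)
Lemma expectation_escape_forward n z : 0 <= z <= h ->
  (\int[P]_w (escape_prob (z + Y n w))%:E =
   (escape_prob z - (h * mu + 2)^-1)%:E)%E.
Proof.
move=> /[dup] zh /andP[z0 hz].
rewrite (@expectation_exponential_affine _ _ _ _ mu (Y n) mu_gt0
  (beam_length model n) (h - z) (escape_prob z) (- (mu / (h * mu + 2))) 0
  (fun y => escape_prob (z + y))).
- rewrite escape_prob_slab//; congr EFin.
  set e := expR _; field; rewrite !gt_eqF//.
- by rewrite subr_ge0.
- apply: measurableT_comp; first exact: measurable_escape_prob.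
  exact: measurable_funD.
- by move=> y; exact: escape_prob_itv.
- move=> y /andP[y0 yhz]; rewrite !escape_prob_slab//; last lra.
  by field; rewrite gt_eqF.
- move=> y yhz; rewrite /escape_prob ltNge (_ : 0 <= z + y)/=; last lra.
  by rewrite leNgt (_ : h < z + y)//; lra.
Qed.

(** Mirror image of the forward step: with a mean overshoot [1 / mu] below depth 0, the continued
    affine formula averages to 1, and the exponential cancels again. *)
Lemma expectation_escape_backward n z : 0 <= z <= h ->
  (\int[P]_w (escape_prob (z - Y n w))%:E =
   (escape_prob z + (h * mu + 2)^-1)%:E)%E.
Proof.
move=> /[dup] zh /andP[z0 hz].
rewrite (@expectation_exponential_affine _ _ _ _ mu (Y n) mu_gt0
  (beam_length model n) z (escape_prob z) (mu / (h * mu + 2)) 1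
  (fun y => escape_prob (z - y)))//.
- rewrite escape_prob_slab//; congr EFin.
  set e := expR _; field; rewrite !gt_eqF//.
- apply: measurableT_comp; first exact: measurable_escape_prob.
  exact: measurable_funB.
- by move=> y; exact: escape_prob_itv.
- move=> y /andP[y0 yhz]; rewrite !escape_prob_slab//; last lra.
  by field; rewrite gt_eqF.
- by move=> y yz; rewrite /escape_prob (_ : z - y < 0)//; lra.
Qed.

Lemma independent_sign_length n (A B : set R) : measurable A -> measurable B ->
  P (s n @^-1` A `&` Y n @^-1` B) = (P (s n @^-1` A) * P (Y n @^-1` B))%E.
Proof.
move=> mA mB.
have mX i (C : set R) : measurable C ->
    <<s cylinders X [fset i]%fset >> (X i @^-1` C).
  move=> mC; have := @measurable_cylinders_RV _ _ _ _ _ X [fset i]%fset i.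
  by rewrite !inE eqxx => /(_ isT measurableT _ mC); rewrite setTI.
apply: (independent_cylinders (beam_independent model)
  (J := [fset Some (inr n)]%fset) (K := [fset Some (inl n)]%fset)).
- by apply/fdisjointP => i; rewrite !inE => /eqP ->.
- exact: (mX (Some (inr n))).
- exact: (mX (Some (inl n))).
Qed.

(** The model prescribes only the masses of two atoms; they add up to 1, so all other values have
    probability 0. *)
Lemma sign_ae n : {ae P, forall w, s n w = 1 \/ s n w = -1}.
Proof.
have [s1 sN1] := beam_sign model n.
have m1 (a : R) : measurable [set w | s n w = a].
  exact: (measurable_funPTI (s n) (measurable_set1 a)).
set U := [set w | s n w = 1] `|` [set w | s n w = -1].
have mU : measurable U by exact: measurableU.
exists (~` U); split => //; first exact: measurableC.
have -> : P (~` U) = (1 - P U)%E by rewrite probability_setC.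
have -> : P U = (2^-1%:E + 2^-1%:E)%E.
  rewrite -{1}s1 -sN1 measureU//.
  by apply/seteqP; split => w //= -[->]; lra.
have half : 2^-1 + 2^-1 = 1 :> R by lra.
by rewrite -EFinD half subrr.
Qed.

Lemma expectation_sign_length n (a : R) (g : R -> R) :
  measurable_fun setT g -> (forall y, 0 <= g y) ->
  P [set w | s n w = a] = (2^-1)%:E ->
  (\int[P]_w (\1_[set a] (s n w) * g (Y n w))%:E =
   2^-1%:E * \int[P]_w (g (Y n w))%:E)%E.
Proof.
move=> mg g0 sa.
rewrite (integral_independent (W := s n) (V := Y n)
  (phi := fun p => (\1_[set a] p.1 * g p.2)%:E))//=; last 3 first.
- exact: independent_sign_length.
- apply/measurable_EFinP/measurable_funM; last exact: measurableT_comp.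
  exact: (measurableT_comp (measurable_indic _)).
- by move=> p; rewrite lee_fin mulr_ge0.
have mgY : measurable_fun setT (fun w => (g (Y n w))%:E).
  by apply/measurable_EFinP; exact: measurableT_comp.
under eq_integral => w _.
  under eq_integral do rewrite EFinM.
  rewrite ge0_integralZl//; last by move=> ? _; rewrite lee_fin.
  over.
rewrite /= ge0_integralZr//; last 2 first.
- by apply/measurable_EFinP; exact: (measurableT_comp (measurable_indic _)).
- by apply: integral_ge0 => w _; rewrite lee_fin.
congr (_ * _)%E; rewrite -sa -[in RHS](setIT [set w | s n w = a]).
rewrite -integral_indic//.
exact: (measurable_funPTI (s n) (measurable_set1 a)).
Qed.

Lemma escape_prob_harmonic n z : 0 <= z <= h ->
  (\int[P]_w (escape_prob (z + step n w))%:E = (escape_prob z)%:E)%E.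
Proof.
move=> zh; have [s1 sN1] := beam_sign model n.
have q0 y : 0 <= escape_prob y by have /andP[] := escape_prob_itv y.
have mf : measurable_fun setT (fun y => escape_prob (z + y)).
  by apply: (measurableT_comp measurable_escape_prob); exact: measurable_funD.
have mb : measurable_fun setT (fun y : R => escape_prob (z - y)).
  by apply: (measurableT_comp measurable_escape_prob); exact: measurable_funB.
have mfY : measurable_fun setT
    (fun w => (\1_[set 1] (s n w) * escape_prob (z + Y n w))%:E).
  apply/measurable_EFinP/measurable_funM; last exact: (measurableT_comp mf).
  exact: (measurableT_comp (measurable_indic _)).
have mbY : measurable_fun setT
    (fun w => (\1_[set -1] (s n w) * escape_prob (z - Y n w))%:E).
  apply/measurable_EFinP/measurable_funM; last exact: (measurableT_comp mb).
  exact: (measurableT_comp (measurable_indic _)).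
(* Split according to the sign. The identity of integrands holds only almost everywhere, where the
   sign is 1 or -1; the two opposite changes of the mean, each with weight one half, then cancel. *)
transitivity (\int[P]_w ((\1_[set 1] (s n w) * escape_prob (z + Y n w))%:E
    + (\1_[set -1] (s n w) * escape_prob (z - Y n w))%:E))%E.
  apply: ge0_ae_eq_integral => //.
  - apply/measurable_EFinP; apply: (measurableT_comp mf).
    exact: measurable_funM.
  - exact: emeasurable_funD.
  - by move=> w _; rewrite lee_fin.
  - by move=> w _; rewrite -EFinD lee_fin addr_ge0 ?mulr_ge0.
  apply: filterS (sign_ae n) => w sw _.
  rewrite /step -EFinD !indicE !in_set1; case: sw => ->.
    rewrite eqxx (_ : (1 == -1 :> R) = false) ?mul1r ?mul0r ?addr0//.
    by apply/negbTE; lra.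
  rewrite eqxx (_ : (-1 == 1 :> R) = false) ?mulN1r ?mul1r ?mul0r ?add0r//.
  by apply/negbTE; lra.
rewrite ge0_integralD//; last 2 first.
- by move=> w _; rewrite lee_fin mulr_ge0.
- by move=> w _; rewrite lee_fin mulr_ge0.
rewrite (expectation_sign_length (a := 1)
  (g := fun y => escape_prob (z + y)))//.
rewrite (expectation_sign_length (a := -1)
  (g := fun y => escape_prob (z - y)))//.
rewrite expectation_escape_forward// expectation_escape_backward//.
by rewrite -!EFinM -EFinD; congr EFin; lra.
Qed.

(** * Independence of the next step from the past *)

Lemma measurable_past n d' (T' : measurableType d') (f : T -> T') :
  measurable_fun [set: past n] (f : past n -> T') -> measurable_fun setT f.
Proof.
move=> mf _ A mA; have := mf measurableT A mA; rewrite setTI.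
apply: smallest_sub; first exact: sigma_algebra_measurable.
exact: measurable_cylinders.
Qed.

Lemma measurable_step_RV n : measurable_fun setT (step n).
Proof. exact: measurable_funM. Qed.

Lemma measurable_depth_RV n : measurable_fun setT (Z n).
Proof. exact: measurable_past (measurable_depth (leqnn n)). Qed.

Lemma measurable_survivesT n : measurable (survives n).
Proof.
apply: bigcap_measurable => [|k kn]; first by exists 0.
by rewrite -[X in measurable X]setTI; apply: measurable_depth_RV.
Qed.

Lemma independent_past_present n d1 d2 (T1 : measurableType d1)
    (T2 : measurableType d2) (W : T -> T1) (V : T -> T2) :
  measurable_fun [set: past n] (W : past n -> T1) ->
  measurable_fun [set: g_sigma_algebraType (cylinders X (present n))]
    (V : g_sigma_algebraType (cylinders X (present n)) -> T2) ->
  forall A B, measurable A -> measurable B ->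
  P (W @^-1` A `&` V @^-1` B) = (P (W @^-1` A) * P (V @^-1` B))%E.
Proof.
move=> mW mV A B mA mB.
apply: (independent_cylinders (beam_independent model) (history_present n)).
  by have := mW measurableT A mA; rewrite setTI.
by have := mV measurableT B mB; rewrite setTI.
Qed.

(** * The integrals [a n] of the overview and their recursion *)

Let value n := (\int[P]_w (\1_(survives n) w * escape_prob (Z n w))%:E)%E.

Let escape_prob_ge0 z : 0 <= escape_prob z.
Proof. by have /andP[] := escape_prob_itv z. Qed.

(** The martingale step: the indicator of survival and the depth [Z n] are functions of the past, so
    they can be frozen while the independent next step is averaged. On survival [Z n] lies in the
    slab and harmonicity applies; off it both sides vanish. *)
Lemma value_next n :
  value n = (\int[P]_w (\1_(survives n) w * escape_prob (Z n.+1 w))%:E)%E.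
Proof.
pose W w : R * R := (\1_(survives n) w, Z n w).
have mW : measurable_fun [set: past n] (W : past n -> _).
  apply: measurable_fun_pair; last exact: measurable_depth.
  apply: (@measurable_indic _ (past n)); exact: measurable_survives.
(* The absolute value makes [phi] nonnegative everywhere. *)
pose phi (p : R * R * R) := (`|p.1.1| * escape_prob (p.1.2 + p.2))%:E.
have mphi : measurable_fun setT phi.
  apply/measurable_EFinP/measurable_funM.
    apply: measurableT_comp => //.
    exact: (measurableT_comp measurable_fst measurable_fst).
  apply: (measurableT_comp measurable_escape_prob).
  apply: measurable_funD => //.
  exact: (measurableT_comp measurable_snd measurable_fst).
transitivity (\int[P]_w phi (W w, step n w))%E; last first.
  by apply: eq_integral => w _; rewrite /phi /W/= depthS ger0_norm.
rewrite (integral_independent (P := P) (W := W) (V := step n)) //; first last.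
- by move=> p; rewrite lee_fin mulr_ge0.
- refine (independent_past_present (n := n) (W := W) (V := step n) mW _).
  exact: measurable_step.
- exact: measurable_step_RV.
- exact: measurable_past mW.
apply: eq_integral => w _; rewrite /phi /W/= indicE.
have [wS|wS] := boolP (w \in survives n); last first.
  rewrite mul0r; apply/esym/integral0_eq => w' _.
  by rewrite normr0 mul0r.
under eq_integral do rewrite normr1 mul1r.
rewrite mul1r escape_prob_harmonic//.
by move/set_mem: wS => /(_ n (leqnn n)); rewrite /= in_itv.
Qed.

Let exits_below n : set T := survives n `&` [set w | Z n.+1 w < 0].

Lemma measurable_exits_below n : measurable (exits_below n).
Proof.
apply: measurableI; first exact: measurable_survivesT.
have -> : [set w | Z n.+1 w < 0] = setT `&` Z n.+1 @^-1` `]-oo, 0[.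
  by rewrite setTI; apply/seteqP; split => w /=; rewrite in_itv.
exact: measurable_depth_RV.
Qed.

Lemma survivesS n w :
  survives n.+1 w <-> survives n w /\ 0 <= Z n.+1 w <= h.
Proof.
split=> [H|[H Hn] k /=]; last first.
  by rewrite leq_eqVlt => /predU1P[->|]; [rewrite /= in_itv|exact: H].
split; first by move=> k kn; apply: H; exact: leqW.
by have := H n.+1 (leqnn _); rewrite /= in_itv.
Qed.

(** After [value_next], the integrand splits pointwise by the position of [Z n.+1]: below the slab
    [escape_prob] is 1 and gives the exit indicator, inside it gives the next integrand, above it is
    0. *)
Lemma value_decomp n : value n = (P (exits_below n) + value n.+1)%E.
Proof.
rewrite value_next.
have mE := measurable_exits_below n.
have -> : P (exits_below n) = (\int[P]_w (\1_(exits_below n) w)%:E)%E.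
  by rewrite integral_indic// setIT.
have mv : measurable_fun setT (fun w =>
    (\1_(survives n.+1) w * escape_prob (Z n.+1 w))%:E).
  apply/measurable_EFinP/measurable_funM.
    exact: (measurable_indic (measurable_survivesT _)).
  apply: (measurableT_comp measurable_escape_prob); exact: measurable_depth_RV.
rewrite -ge0_integralD//.
- apply: eq_integral => w _; rewrite -EFinD; congr EFin; rewrite !indicE.
  have [wS|wS] := boolP (w \in survives n); last first.
    have {}wS : ~ survives n w by move=> /mem_set; rewrite (negbTE wS).
    rewrite mul0r (@memNset _ (exits_below n)) => [|[]//].
    by rewrite (@memNset _ (survives n.+1)) ?mul0r ?addr0// => /survivesS[].
  rewrite mul1r; move/set_mem: wS => wS.
  have [Z0|Z0] := ltP (Z n.+1 w) 0.
    rewrite (@mem_set _ (exits_below n))//.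
    rewrite (@memNset _ (survives n.+1)); last first.
      by move=> /survivesS[_]; rewrite leNgt Z0.
    by rewrite mul0r addr0 /escape_prob Z0.
  rewrite (@memNset _ (exits_below n)) ?add0r; last first.
    by move=> [_]/=; rewrite ltNge Z0.
  have [Zh|Zh] := leP (Z n.+1 w) h.
    rewrite (@mem_set _ (survives n.+1)) ?mul1r//.
    by apply/survivesS; rewrite Z0 Zh.
  rewrite (@memNset _ (survives n.+1)) ?mul0r; last first.
    by move=> /survivesS[_ /andP[_]]; rewrite leNgt Zh.
  by rewrite /escape_prob ltNge Z0/= leNgt Zh.
- apply/measurable_EFinP; exact: (measurable_indic (measurable_exits_below _)).
- by move=> w _; rewrite lee_fin mulr_ge0.
Qed.

(** * Geometric decay of survival and summation of the recursion *)

Lemma survives_bound n :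
  (P (survives n) <= ((1 - expR (- (mu * h))) ^+ n)%:E)%E.
Proof.
set r := 1 - _.
elim: n => [|n IHn].
  by rewrite expr0 probability_le1//; exact: measurable_survivesT.
have [N [mN N0 sN]] := sign_ae n.
pose B := Y n @^-1` `]-oo, h].
have mB : measurable B by exact: measurable_funPTI.
have PB : P B = r%:E.
  rewrite -(exponential_le (beam_length model n) (ltW h_gt0)).
  by congr (P _); apply/seteqP; split => w /=; rewrite in_itv.
(* Two consecutive depths in the slab differ by at most [h]; off the null set [N] the sign is 1 or
   -1, so the length [Y n] is at most [h] too. *)
have sub : survives n.+1 `<=` (survives n `&` B) `|` N.
  move=> w /survivesS[wS Zh].
  have [|wN] := pselect (N w); first by right.
  left; split => //; rewrite /B/= in_itv/=.
  have sw : s n w = 1 \/ s n w = -1.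
    by apply: contrapT => sw; apply: wN; exact: sN.
  have := wS n (leqnn n); rewrite /= in_itv/= => /andP[Z0 Zn].
  move: Zh; rewrite depthS /step; case: sw => ->; lra.
have mS := measurable_survivesT n.
apply: (@le_trans _ _ (P ((survives n `&` B) `|` N))).
  apply: le_measure => //; rewrite inE; first exact: measurable_survivesT.
  by apply: measurableU => //; exact: measurableI.
apply: (@le_trans _ _ (P (survives n `&` B) + P N)%E).
  by apply: measureU2 => //; exact: measurableI.
rewrite N0 addr0.
(* [B] involves only [Y n], which belongs to [present n], while [survives n] belongs to the past. *)
have -> : P (survives n `&` B) = (P (survives n) * P B)%E.
  apply: (independent_cylinders (beam_independent model) (history_present n)).
    exact: measurable_survives.
  have := @measurable_cylinders_RV _ _ _ _ _ X (present n) (Some (inl n)).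
  rewrite !inE eqxx.
  move=> /(_ isT measurableT `]-oo, h]%classic (measurable_itv _)).
  by rewrite setTI.
rewrite PB exprSr EFinM; apply: lee_wpmul2r => //.
by rewrite -PB measure_ge0.
Qed.

Lemma value_le n : (value n <= P (survives n))%E.
Proof.
have mS := measurable_survivesT n.
have -> : P (survives n) = (\int[P]_w (\1_(survives n) w)%:E)%E.
  by rewrite integral_indic// setIT.
apply: ge0_le_integral => //.
- by move=> w _; rewrite lee_fin mulr_ge0.
- apply/measurable_EFinP/measurable_funM.
    exact: (measurable_indic (measurable_survivesT _)).
  apply: (measurableT_comp measurable_escape_prob); exact: measurable_depth_RV.
- apply/measurable_EFinP; exact: (measurable_indic (measurable_survivesT _)).
- move=> w _; rewrite lee_fin ler_piMr//.
  by have /andP[] := escape_prob_itv (Z n w).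
Qed.

Lemma value_ge0 n : (0 <= value n)%E.
Proof. by apply: integral_ge0 => w _; rewrite lee_fin mulr_ge0. Qed.

Lemma value_cvg0 : value @ \oo --> 0%E.
Proof.
set r := 1 - expR (- (mu * h)).
have e1 : expR (- (mu * h)) < 1 by rewrite -expR0 ltr_expR oppr_lt0 mulr_gt0.
have r1 : `|r| < 1.
  rewrite ger0_norm /r; last lra.
  by have := expR_gt0 (- (mu * h)); lra.
apply: (@squeeze_cvge _ _ _ _ (cst 0%E) _ (fun n => (r ^+ n)%:E)).
- apply: nearW => n; rewrite value_ge0/=.
  exact: le_trans (value_le n) (survives_bound n).
- exact: cvg_cst.
- by apply/cvg_EFin; [exact: nearW|exact: cvg_expr].
Qed.

Lemma value0_exits : P (\bigcup_n exits_below n) = value 0.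
Proof.
have cP : (\sum_(0 <= i < n) P (exits_below i))%E @[n --> \oo] -->
    P (\bigcup_n exits_below n).
  apply: measure_semi_sigma_additive.
  - exact: measurable_exits_below.
  - apply: ltn_trivIset => m n mn.
    apply/seteqP; split => // w [[_ Zn]] [Sn _].
    by have := Sn _ mn; rewrite /= in_itv/= leNgt Zn.
  - by apply: bigcup_measurable => n _; exact: measurable_exits_below.
have E n : value 0 = (\sum_(0 <= i < n) P (exits_below i) + value n)%E.
  elim: n => [|n ->]; first by rewrite big_nil add0e.
  by rewrite big_nat_recr//= -addeA -value_decomp.
have : (\sum_(0 <= i < n) P (exits_below i) + value n)%E @[n --> \oo] -->
    (P (\bigcup_n exits_below n) + 0)%E.
  apply: cvgeD => //; last exact: value_cvg0.
  by rewrite fin_num_adde_defl.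
(* By [E] the sequence is constantly [value 0], so uniqueness of limits identifies this constant
   with the probability of the union. *)
rewrite adde0; under eq_fun do rewrite -E.
move=> /(cvg_unique _ _) H; apply/esym; apply: H => //; exact: cvg_cst.
Qed.

(** * Evaluation of the integral at time 0 *)

Lemma value0E : value 0 =
  (((1 - c) * (1 - expR (- (h * mu / c))) + h * mu) / (h * mu + 2))%:E.
Proof.
(* The integrand of [value 0] as a function of the first length alone. *)
pose g y := if 0 <= y * c then
    if y * c <= h then escape_prob (y * c) else 0 else 0.
have mc : measurable_fun setT (fun y : R => y * c) by exact: measurable_funM.
transitivity (\int[P]_w (g (x w))%:E)%E.
  apply: eq_integral => w _; congr EFin; rewrite indicE /g.
  have Z0 : Z 0 w = x w * c by rewrite /Z /scattering_depth big_ord0 addr0.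
  have S0 : survives 0 w <-> 0 <= x w * c <= h.
    split=> [/(_ 0%N (leqnn _))|xh k]; first by rewrite /= in_itv/= Z0.
    by rewrite /= leqn0 => /eqP ->; rewrite in_itv/= Z0.
  have [/set_mem/S0/andP[-> ->]|/negP wS] := boolP (w \in survives 0).
    by rewrite mul1r Z0.
  rewrite mul0r; case: ifPn => // x0; case: ifPn => // xh.
  by exfalso; apply: wS; apply/mem_set/S0; rewrite x0 xh.
(* The first depth [y * c] reaches [h] at length [h / c], which is the cutoff and the source of the
   exponent [h mu / c]; the slope of [q] is scaled by [c]. The coefficient of the exponential is now
   [(1 - c) / (h mu + 2)], which need not vanish because the first depth has mean [c / mu]. *)
rewrite (@expectation_exponential_affine _ _ _ _ mu x mu_gt0
  (beam_first_length model) (h / c) ((1 + h * mu) / (h * mu + 2))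
  (- (c * mu / (h * mu + 2))) 0 g).
- congr EFin; rewrite (_ : mu * (h / c) = h * mu / c); last first.
    by field; rewrite gt_eqF.
  set e := expR _; field; rewrite !gt_eqF//.
- by rewrite divr_ge0 ?ltW.
- apply: measurable_fun_ifT => //; first exact: measurable_fun_ler.
  apply: measurable_fun_ifT => //; first exact: measurable_fun_ler.
  exact: (measurableT_comp measurable_escape_prob).
- move=> y; rewrite /g; case: ifP => _; last by rewrite lexx ler01.
  by case: ifP => _; [exact: escape_prob_itv|rewrite lexx ler01].
- move=> y /andP[y0]; rewrite ler_pdivlMr// => yh.
  have yc : 0 <= y * c by rewrite mulr_ge0// ltW.
  rewrite /g yc yh escape_prob_slab ?yc//; field; rewrite gt_eqF//.
- move=> y; rewrite ltr_pdivrMr// => hy.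
  by rewrite /g [_ <= h]leNgt hy/=; case: ifP.
Qed.

(** * The reflection event as a union of exits below the slab *)

Lemma reflectedE : reflected x Y s h theta =
  \bigcup_n ([set w | Z 0 w <= h] `&`
    (\bigcap_(k in [set k | (1 <= k <= n)%N]) (Z k @^-1` `[0, h])) `&`
    [set w | Z n.+1 w < 0]).
Proof.
have Z0 w : Z 0 w = first_depth x theta w.
  by rewrite /Z /scattering_depth big_ord0 addr0.
have inside z : ~ outside_slab h z <-> 0 <= z <= h.
  rewrite /outside_slab; split=> [/not_orP[/negP + /negP]|/andP[z0 zh] []].
  - by rewrite -!leNgt => -> ->.
  - by rewrite ltNge z0.
  - by rewrite ltNge zh.
(* The stopping time is at least 1, so time 0 is excluded and stopping at [n.+1] corresponds to
   index [n] of the union. *)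
apply/seteqP; split => [w [wh [[|n] [[n1 _ H] Zn]]] //|w [n _ [[/= wh H] Zn]]].
  exists n => //; split => //; split; first by rewrite /= Z0.
  by move=> k /= kn; rewrite in_itv/=; apply/inside; exact: H.
split; first by rewrite -Z0.
exists n.+1; split => //; split => //; first by left.
by move=> k kn; apply/inside; have := H k kn; rewrite /= in_itv.
Qed.

(** The event [reflected] contains the union of the [exits_below n], and exceeds it only by outcomes
    with a negative first depth. These have [x w < 0], since the cosine is positive, and form a null
    event by the exponential law. *)
Lemma reflection_fractionE : reflection_fraction x Y s h theta = value 0.
Proof.
rewrite -value0_exits /reflection_fraction.
have mZ n : measurable [set w | Z n w < 0].
  have -> : [set w | Z n w < 0] = setT `&` Z n @^-1` `]-oo, 0[.
    by rewrite setTI; apply/seteqP; split => w /=; rewrite in_itv.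
  exact: measurable_depth_RV.
have mr : measurable (reflected x Y s h theta).
  rewrite reflectedE; apply: bigcup_measurable => n _; apply: measurableI => //.
  apply: measurableI.
    have -> : [set w | Z 0 w <= h] = setT `&` Z 0 @^-1` `]-oo, h].
      by rewrite setTI; apply/seteqP; split => w /=; rewrite in_itv.
    exact: measurable_depth_RV.
  apply: bigcap_measurableType => k _.
  by rewrite -[X in measurable X]setTI; apply: measurable_depth_RV.
have mE : measurable (\bigcup_n exits_below n).
  by apply: bigcup_measurable => n _; exact: measurable_exits_below.
pose N := [set w | x w < 0].
have mN : measurable N.
  have -> : N = x @^-1` `]-oo, 0[.
    by apply/seteqP; split => w /=; rewrite in_itv.
  exact: measurable_funPTI.
apply/eqP; rewrite eq_le; apply/andP; split; last first.
  apply: le_measure; rewrite ?inE// reflectedE.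
  move=> w [n _ [wS Zn]]; exists n => //; split => //; split.
    by have := wS 0%N (leq0n n); rewrite /= in_itv/= => /andP[].
  by move=> k /= /andP[_ kn]; exact: wS.
apply: (@le_trans _ _ (P (\bigcup_n exits_below n) + P N)%E); last first.
  by rewrite [P N](exponential_lt0 (beam_first_length model)) addr0.
apply: (@le_trans _ _ (P ((\bigcup_n exits_below n) `|` N))%E); last first.
  exact: measureU2.
apply: le_measure; rewrite ?inE//; first exact: measurableU.
rewrite reflectedE => w [n _ [[/= wh wS] Zn]].
have [x0|x0] := ltP (x w) 0; [by right|left].
exists n => //; split => // k /= kn.
have [->|k0] := eqVneq k 0%N; last by apply: wS; rewrite /= lt0n k0.
rewrite in_itv/= wh andbT /Z /scattering_depth big_ord0 addr0.
by rewrite mulr_ge0// ltW.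
Qed.

End reflection.

Theorem theorem3 (R : realType) (d : measure_display) (T : measurableType d)
    (P : probability T R) (h mu theta : R)
    (x : {RV P >-> R}) (Y s : nat -> {RV P >-> R}) :
  0 < h -> 0 < mu -> 0 <= theta < pi / 2 ->
  beam_model x Y s mu ->
  reflection_fraction x Y s h theta =
  (((1 - cos theta) * (1 - expR (- (h * mu / cos theta))) + h * mu)
     / (h * mu + 2))%:E.
Proof.
move=> h0 mu0 /andP[th0 thpi] model.
have cos0 : 0 < cos theta.
  apply: cos_gt0_pihalf; rewrite thpi andbT (lt_le_trans _ th0)// oppr_lt0.
  by rewrite divr_gt0// pi_gt0.
by rewrite (reflection_fractionE h0 mu0 cos0 model) (value0E h0 mu0 cos0 model).
Qed.
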